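(* Let $g\ge1$ and let $s_\infty\in A_{4g}$ be a product of $2g+2$ disjoint cycles (on all of $\{1,\dots,4g\}$, cycles of length $1$ included) of lengths $2n_1+1,\dots,2n_{2g+2}+1$, where $n_i\ge0$ are integers with $\sum_{i=1}^{2g+2}n_i=g-1$. Then there exists a homomorphism $m:\pi_1(U,0)\to A_{4g}$ with $m(\gamma_\infty)=s_\infty$ such that $m(\gamma_i)$ is a $3$-cycle and $m(\iota_*\gamma_i)=\ell^{-1}m(\gamma_i)\ell$ for every $i=1,\dots,2g$.
   Context: Let $\mathbb{P}^1=\mathbb{C}\cup\{\infty\}$ and let $\iota(z)=-z$. Fix points $B_1,\dots,B_{2g}\in\mathbb{P}^1\setminus\{0,\infty\}$ such that the $4g$ points $B_1,\dots,B_{2g},\iota B_1,\dots,\iota B_{2g}$ are distinct, and let $U=\mathbb{P}^1\setminus\{\infty,B_1,\dots,B_{2g},\iota B_1,\dots,\iota B_{2g}\}$. Let $\gamma_i\in\pi_1(U,0)$ be the class of a simple loop around $B_i$, chosen so that $\pi_1(U,0)$ is the free group generated by $\gamma_1,\dots,\gamma_{2g},\iota_*\gamma_1,\dots,\iota_*\gamma_{2g}$, and so that $$\gamma_\infty:=\gamma_1\cdots\gamma_{2g}\,\iota_*\gamma_1\cdots\iota_*\gamma_{2g}$$ is the class of a simple loop around $\infty$. Here $\iota_*$ is the automorphism of $\pi_1(U,0)$ induced by $\iota$. Let $\ell=(1,2)(3,4)\cdots(4g-1,4g)\in A_{4g}$, where $A_{4g}$ is the alternating group on $\{1,\dots,4g\}$.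 *)

(* Defs.v *)
From HB Require Import structures.
From mathcomp Require Import all_boot all_order all_algebra.
From mathcomp Require Import all_fingroup all_solvable complex.
From mathcomp Require Import all_classical all_reals all_analysis.
From mathcomp Require Import homotopy lra ring.

Set Implicit Arguments.
Unset Strict Implicit.
Unset Printing Implicit Defensive.

Import Order.TTheory GRing.Theory Num.Theory.
Import numFieldNormedType.Exports.

Local Open Scope classical_set_scope.
Local Open Scope quotient_scope.
Local Open Scope ring_scope.

Section ContinuityHelpers.

Lemma ccomp (S T V : topologicalType) (f : S -> T) (g : T -> V) :
  continuous f -> continuous g -> continuous (g \o f).
Proof. by move=> cf cg s; apply: continuous_comp; [exact: cf|exact: cg]. Qed.

Lemma cpair (S T V : topologicalType) (f : S -> T) (g : S -> V) :
  continuous f -> continuous g -> continuous (fun s => (f s, g s)).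
Proof. by move=> cf cg s; exact: cvg_pair (cf s) (cg s). Qed.

Lemma cfst (S T : topologicalType) : continuous (fun st : S * T => st.1).
Proof. by move=> st; exact: cvg_fst. Qed.

Lemma csnd (S T : topologicalType) : continuous (fun st : S * T => st.2).
Proof. by move=> st; exact: cvg_snd. Qed.

Lemma csub (R : realType) (T : topologicalType) (f g : T -> R) :
  continuous f -> continuous g -> continuous (fun t => f t - g t).
Proof. by move=> cf cg t; apply: cvgB; [exact: cf|exact: cg]. Qed.

Lemma cadd (R : realType) (T : topologicalType) (f g : T -> R) :
  continuous f -> continuous g -> continuous (fun t => f t + g t).
Proof. by move=> cf cg t; apply: cvgD; [exact: cf|exact: cg]. Qed.

Lemma cmul (R : realType) (T : topologicalType) (f g : T -> R) :
  continuous f -> continuous g -> continuous (fun t => f t * g t).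
Proof. by move=> cf cg t; apply: cvgM; [exact: cf|exact: cg]. Qed.

Lemma cmax (R : realType) (T : topologicalType) (f g : T -> R) :
  continuous f -> continuous g -> continuous (fun t => Num.max (f t) (g t)).
Proof.
by move=> cf cg t; apply: (@continuous_max R T f g t); [exact: cf|exact: cg].
Qed.

Lemma ccst (T V : topologicalType) (c : V) : continuous (fun _ : T => c).
Proof. by move=> t; exact: cst_continuous. Qed.

Lemma ifcont (R : realType) (T X : topologicalType) (u : T -> R) (c : R)
    (F G : T -> X) :
  continuous u -> continuous F -> continuous G ->
  (forall t, u t = c -> F t = G t) ->
  continuous (fun t => if u t <= c then F t else G t).
Proof.
move=> cu cF cG FG t.
have [utc|utc|utc] := ltgtP (u t) c.
- rewrite /continuous_at /= (ltW utc); apply: cvg_trans (cF t).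
  apply: near_eq_cvg; near=> z.
  rewrite ifT//; apply: ltW; near: z.
  exact: (cu t [set y | y < c] (lt_nbhsl utc)).
- rewrite /continuous_at /= leNgt utc/=; apply: cvg_trans (cG t).
  apply: near_eq_cvg; near=> z.
  rewrite leNgt ifF//; apply/negbTE; rewrite negbK; near: z.
  exact: (cu t [set y | c < y] (lt_nbhsr utc)).
- rewrite /continuous_at /= utc lexx => A FA.
  have GA : nbhs (G t) A by rewrite -(FG t utc).
  have hF : nbhs t (F @^-1` A) by exact: cF.
  have hG : nbhs t (G @^-1` A) by exact: cG.
  suff : nbhs t ((fun t => if u t <= c then F t else G t) @^-1` A) by [].
  by apply: filterS2 hF hG => z /= ? ?; case: ifP.
Unshelve. all: by end_near. Qed.

End ContinuityHelpers.

Definition unit_interval (R : realType) : Type := set_type `[0 : R, 1].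

Section UnitInterval.
Context {R : realType}.
Local Notation I := (unit_interval R).

HB.instance Definition _ := Choice.on I.
HB.instance Definition _ := Topological.copy I (set_type `[0 : R, 1]).

Definition ival (t : I) : R := set_val t.

Lemma ival_ge0 (t : I) : 0 <= ival t.
Proof. by have := set_valP t; rewrite /= in_itv/= => /andP[]. Qed.

Lemma ival_le1 (t : I) : ival t <= 1.
Proof. by have := set_valP t; rewrite /= in_itv/= => /andP[]. Qed.

Lemma ival_inj : injective ival.
Proof. exact: val_inj. Qed.

Lemma clamp_subproof (x : R) : Num.max 0 (Num.min x 1) \in `[0 : R, 1]%classic.
Proof.
apply/mem_set; rewrite /= in_itv/= le_max lexx/= ge_max ler01/=.
by rewrite ge_min lexx orbT.
Qed.

Definition clamp (x : R) : I := 
  @exist R (fun y => y \in `[0 : R, 1]%classic) _ (clamp_subproof x).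

Lemma ival_clamp (x : R) : ival (clamp x) = Num.max 0 (Num.min x 1).
Proof. by []. Qed.

Lemma ivalK : cancel ival clamp.
Proof.
move=> t; apply: ival_inj; rewrite ival_clamp min_l ?ival_le1// max_r//.
exact: ival_ge0.
Qed.

Lemma clampK (x : R) : 0 <= x <= 1 -> ival (clamp x) = x.
Proof. by case/andP=> x0 x1; rewrite ival_clamp min_l// max_r. Qed.

Lemma clamp_le0 (x : R) : x <= 0 -> clamp x = clamp 0.
Proof.
move=> x0; apply: ival_inj; rewrite !ival_clamp min_l; last first.
  exact: le_trans x0 ler01.
by rewrite max_l// min_l ?ler01// max_l.
Qed.

Lemma clamp_ge1 (x : R) : 1 <= x -> clamp x = clamp 1.
Proof. by move=> x1; apply: ival_inj; rewrite !ival_clamp min_r// minxx. Qed.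

Lemma clamp01_neq : clamp 0 != clamp 1.
Proof.
apply/eqP => /(congr1 ival); rewrite !clampK ?lexx ?ler01// => /esym/eqP.
by rewrite oner_eq0.
Qed.

HB.instance Definition _ := isBiPointed.Build I clamp01_neq.

Lemma zeroE : zero = clamp 0 :> I. Proof. by []. Qed.
Lemma oneE : one = clamp 1 :> I. Proof. by []. Qed.

Lemma ival0 : ival zero = 0. Proof. by rewrite clampK// lexx ler01. Qed.
Lemma ival1 : ival one = 1. Proof. by rewrite clampK// lexx ler01. Qed.

Lemma ival_continuous : continuous ival.
Proof. exact: initial_continuous. Qed.

Lemma clamp_continuous : continuous clamp.
Proof.
apply: continuous_comp_initial => x.
have -> : set_val \o clamp = (fun x : R => Num.max 0 (Num.min x 1)) by [].
apply: (@continuous_max R R (cst 0) (fun y => Num.min y 1) x).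
  exact: cst_continuous.
apply: (@continuous_min R R id (cst 1) x); first exact: cvg_id.
exact: cst_continuous.
Qed.

End UnitInterval.

Section PathHomotopy.
Context {R : realType} {X : topologicalType} (x0 : X).
Local Notation I := (unit_interval R).
Local Notation loop := {path I from x0 to x0}%type.

Definition path_homotopic (f g : loop) : Prop :=
  exists H : I * I -> X,
    [/\ continuous H,
        forall t, H (zero, t) = f t,
        forall t, H (one, t) = g t,
        forall s, H (s, zero) = x0
      & forall s, H (s, one) = x0].

Lemma path_homotopic_refl f : path_homotopic f f.
Proof.
exists (fun st => f st.2); split => //.
- exact: ccomp (@csnd I I) (@cts_fun _ _ f).
- by move=> s; rewrite /= path_zero.
- by move=> s; rewrite /= path_one.
Qed.

Definition irev (t : I) : I := clamp (1 - ival t).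

Lemma irev0 : irev zero = one.
Proof. by rewrite /irev ival0 subr0. Qed.
Lemma irev1 : irev one = zero.
Proof. by rewrite /irev ival1 subrr. Qed.

Lemma irev_continuous : continuous irev.
Proof.
apply: (@ccomp I R I (fun t => 1 - ival t)); last exact: clamp_continuous.
exact: csub (@ccst _ _ _) ival_continuous.
Qed.

Lemma path_homotopic_sym f g : path_homotopic f g -> path_homotopic g f.
Proof.
case=> H [cH H0 H1 Hz Ho]; exists (fun st => H (irev st.1, st.2)); split.
- exact: (ccomp (cpair (ccomp (@cfst I I) irev_continuous) (@csnd I I)) cH).
- by move=> t; rewrite /= irev0.
- by move=> t; rewrite /= irev1.
- by move=> s /=.
- by move=> s /=.
Qed.

Definition first_half (t : I) : I := clamp (2 * ival t).
Definition second_half (t : I) : I := clamp (2 * ival t - 1).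

Lemma first_half_continuous : continuous first_half.
Proof.
apply: (@ccomp I R I (fun t => 2 * ival t)); last exact: clamp_continuous.
exact: cmul (@ccst _ _ _) ival_continuous.
Qed.

Lemma second_half_continuous : continuous second_half.
Proof.
apply: (@ccomp I R I (fun t => 2 * ival t - 1)); last exact: clamp_continuous.
exact: csub (cmul (@ccst _ _ _) ival_continuous) (@ccst _ _ _).
Qed.

Lemma first_half_mid t : ival t = 2^-1 -> first_half t = one.
Proof. by move=> tE; rewrite /first_half tE divff ?pnatr_eq0. Qed.

Lemma second_half_mid t : ival t = 2^-1 -> second_half t = zero.
Proof. by move=> tE; rewrite /second_half tE divff ?pnatr_eq0// subrr. Qed.

Lemma first_half0 : first_half zero = zero.
Proof. by rewrite /first_half ival0 mulr0. Qed.

Lemma second_half1 : second_half one = one.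
Proof. by rewrite /second_half ival1 mulr1 -[X in X - _]/(1 + 1) addrK. Qed.

Lemma half_lt1 : (2^-1 : R) < 1.
Proof. by rewrite invf_lt1 ?ltr1n ?ltr0n. Qed.

Lemma path_homotopic_trans f g h :
  path_homotopic f g -> path_homotopic g h -> path_homotopic f h.
Proof.
case=> H [cH H0 H1 Hz Ho] [K [cK K0 K1 Kz Ko]].
exists (fun st => if ival st.1 <= 2^-1 then H (first_half st.1, st.2)
                  else K (second_half st.1, st.2)); split.
- apply: (@ifcont R (I * I)%type X (fun st => ival st.1) 2^-1
    (fun st => H (first_half st.1, st.2))
    (fun st => K (second_half st.1, st.2))).
  + exact: ccomp (@cfst I I) ival_continuous.
  + have c1 := ccomp (@cfst I I) first_half_continuous.
    exact: ccomp (cpair c1 (@csnd I I)) cH.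
  + have c1 := ccomp (@cfst I I) second_half_continuous.
    exact: ccomp (cpair c1 (@csnd I I)) cK.
  + by move=> st stE; rewrite first_half_mid// second_half_mid// H1 K0.
- by move=> t /=; rewrite ival0 invr_ge0 ler0n first_half0.
- by move=> t /=; rewrite ival1 leNgt half_lt1/= second_half1.
- by move=> s /=; case: ifP.
- by move=> s /=; case: ifP.
Qed.

Definition path_homotopicb (f g : loop) : bool := `[< path_homotopic f g >].

Lemma path_homotopicb_refl : reflexive path_homotopicb.
Proof. by move=> f; apply/asboolP; exact: path_homotopic_refl. Qed.

Lemma path_homotopicb_sym : symmetric path_homotopicb.
Proof.
by move=> f g; apply/asboolP/asboolP => /path_homotopic_sym.
Qed.

Lemma path_homotopicb_trans : transitive path_homotopicb.
Proof.
move=> g f h /asboolP fg /asboolP gh; apply/asboolP.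
exact: path_homotopic_trans fg gh.
Qed.

Canonical path_homotopy_equiv :=
  EquivRel path_homotopicb path_homotopicb_refl path_homotopicb_sym
    path_homotopicb_trans.

Definition concat_fun (f g : I -> X) (t : I) : X :=
  if ival t <= 2^-1 then f (first_half t) else g (second_half t).

Lemma concat_continuous (f g : loop) : continuous (concat_fun f g).
Proof.
apply: ifcont.
- exact: ival_continuous.
- exact: ccomp first_half_continuous (@cts_fun _ _ f).
- exact: ccomp second_half_continuous (@cts_fun _ _ g).
- by move=> t tE; rewrite first_half_mid// second_half_mid// path_zero path_one.
Qed.

Lemma concat_zero (f g : loop) : concat_fun f g zero = x0.
Proof. by rewrite /concat_fun ival0 invr_ge0 ler0n first_half0 path_zero. Qed.

Lemma concat_one (f g : loop) : concat_fun f g one = x0.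
Proof. by rewrite /concat_fun ival1 leNgt half_lt1/= second_half1 path_one. Qed.

Definition loop_concat (f g : loop) : loop :=
  mk_path (@concat_continuous f g) (concat_zero f g) (concat_one f g).

Lemma rev_continuous (f : loop) : continuous (f \o irev).
Proof.
exact: ccomp irev_continuous (@cts_fun _ _ f).
Qed.

Lemma rev_zero (f : loop) : (f \o irev) zero = x0.
Proof. by rewrite /= irev0 path_one. Qed.

Lemma rev_one (f : loop) : (f \o irev) one = x0.
Proof. by rewrite /= irev1 path_zero. Qed.

Definition loop_rev (f : loop) : loop :=
  mk_path (@rev_continuous f) (rev_zero f) (rev_one f).

Definition loop_cst : loop := cst x0.

Lemma loop_concat_homotopic f f' g g' :
  path_homotopic f f' -> path_homotopic g g' ->
  path_homotopic (loop_concat f g) (loop_concat f' g').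
Proof.
case=> H [cH H0 H1 Hz Ho] [K [cK K0 K1 Kz Ko]].
exists (fun st => if ival st.2 <= 2^-1 then H (st.1, first_half st.2)
                  else K (st.1, second_half st.2)); split.
- apply: (@ifcont R (I * I)%type X (fun st => ival st.2) 2^-1
    (fun st => H (st.1, first_half st.2))
    (fun st => K (st.1, second_half st.2))).
  + exact: ccomp (@csnd I I) ival_continuous.
  + have c2 := ccomp (@csnd I I) first_half_continuous.
    exact: ccomp (cpair (@cfst I I) c2) cH.
  + have c2 := ccomp (@csnd I I) second_half_continuous.
    exact: ccomp (cpair (@cfst I I) c2) cK.
  + by move=> st stE; rewrite first_half_mid// second_half_mid// Ho Kz.
- by move=> t /=; rewrite /mk_path/= /concat_fun; case: ifP.
- by move=> t /=; rewrite /mk_path/= /concat_fun; case: ifP.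
- by move=> s /=; rewrite ival0 invr_ge0 ler0n first_half0.
- by move=> s /=; rewrite ival1 leNgt half_lt1/= second_half1.
Qed.

Lemma loop_rev_homotopic f g :
  path_homotopic f g -> path_homotopic (loop_rev f) (loop_rev g).
Proof.
case=> H [cH H0 H1 Hz Ho]; exists (fun st => H (st.1, irev st.2)); split.
- exact: (ccomp (cpair (@cfst I I) (ccomp (@csnd I I) irev_continuous)) cH).
- by move=> t; exact: H0.
- by move=> t; exact: H1.
- by move=> s; rewrite /= irev0.
- by move=> s; rewrite /= irev1.
Qed.

(* Two reparametrisations of the same loop with the same endpoints are
   homotopic: slide one into the other inside the (convex) unit interval. *)
Lemma reparam_homotopic (h f g : loop) (phi psi : I -> I) :
  continuous phi -> continuous psi ->
  (forall t, f t = h (phi t)) -> (forall t, g t = h (psi t)) ->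
  phi zero = psi zero -> phi one = psi one ->
  path_homotopic f g.
Proof.
move=> cphi cpsi fE gE e0 e1.
pose c (st : I * I) :=
  ival (phi st.2) + ival st.1 * (ival (psi st.2) - ival (phi st.2)).
have cphi2 : continuous (fun st : I * I => ival (phi st.2)).
  exact: ccomp (ccomp (@csnd I I) cphi) ival_continuous.
have cpsi2 : continuous (fun st : I * I => ival (psi st.2)).
  exact: ccomp (ccomp (@csnd I I) cpsi) ival_continuous.
have cs : continuous (fun st : I * I => ival st.1).
  exact: ccomp (@cfst I I) ival_continuous.
have cc : continuous c.
  exact: cadd cphi2 (cmul cs (csub cpsi2 cphi2)).
exists (fun st => h (clamp (c st))); split.
- exact: ccomp (ccomp cc clamp_continuous) (@cts_fun _ _ h).
- by move=> t; rewrite /c/= ival0 mul0r addr0 ivalK fE.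
- by move=> t; rewrite /c/= ival1 mul1r addrC subrK ivalK gE.
- by move=> s; rewrite /c/= e0 subrr mulr0 addr0 ivalK -gE path_zero.
- by move=> s; rewrite /c/= e1 subrr mulr0 addr0 ivalK -gE path_one.
Qed.

Lemma continuous_clamp_comp (c : I -> R) :
  continuous c -> continuous (fun t => clamp (c t)).
Proof. by move=> cc; exact: ccomp cc clamp_continuous. Qed.

Lemma loop_concatA (f g h : loop) :
  path_homotopic (loop_concat f (loop_concat g h))
                 (loop_concat (loop_concat f g) h).
Proof.
pose c (t : I) : R :=
  Num.max (2^-1 * ival t) (Num.max (ival t - 4^-1) (2 * ival t - 1)).
have cc : continuous c.
  apply: cmax; first exact: cmul (@ccst _ _ _) ival_continuous.
  apply: cmax; first exact: csub ival_continuous (@ccst _ _ _).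
  exact: csub (cmul (@ccst _ _ _) ival_continuous) (@ccst _ _ _).
apply: (reparam_homotopic (h := loop_concat (loop_concat f g) h)
  (phi := fun t => clamp (c t)) (psi := id)) => //.
- exact: continuous_clamp_comp.
- by move=> t; exact: cvg_id.
- move=> t; have t0 := ival_ge0 t; have t1 := ival_le1 t.
  have cE : c t = if ival t <= 2^-1 then 2^-1 * ival t
      else if 2 * ival t - 1 <= 2^-1 then ival t - 4^-1 else 2 * ival t - 1.
    rewrite /c; have [t2|t2] := leP (ival t) 2^-1.
      by rewrite max_l// ge_max; apply/andP; split; lra.
    have [t3|t3] := leP (2 * ival t - 1) 2^-1.
      by rewrite (@max_l _ _ (ival t - 4^-1)) ?max_r//; lra.
    by rewrite (@max_r _ _ (ival t - 4^-1)) ?max_r//; lra.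
  have c01 : 0 <= c t <= 1.
    rewrite cE; have [t2|t2] := leP (ival t) 2^-1.
      by apply/andP; split; lra.
    by have [t3|t3] := leP (2 * ival t - 1) 2^-1; apply/andP; split; lra.
  rewrite /= /mk_path /concat_fun /= /concat_fun.
  rewrite [ival (clamp (c t))]clampK //.
  rewrite /first_half /second_half [ival (clamp (c t))]clampK //.
  have [t2|t2] := leP (ival t) 2^-1.
    have {}cE : c t = 2^-1 * ival t by rewrite cE t2.
    rewrite cE ifT; last lra.
    rewrite clampK; last by apply/andP; split; lra.
    by rewrite ifT; [congr (f (clamp _)); field|lra].
  rewrite [in LHS]clampK; last by apply/andP; split; lra.
  have [t3|t3] := leP (2 * ival t - 1) 2^-1.
    have {}cE : c t = ival t - 4^-1 by rewrite cE leNgt t2/= t3.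
    rewrite cE ifT; last lra.
    rewrite clampK; last by apply/andP; split; lra.
    by rewrite ifF; [congr (g (clamp _)); field|apply/negbTE; rewrite -ltNge; lra].
  have {}cE : c t = 2 * ival t - 1 by rewrite cE leNgt t2/= leNgt t3.
  rewrite cE ifF //.
  by apply/negbTE; rewrite -ltNge; lra.
- rewrite /c ival0 -[RHS]/(clamp 0); congr clamp.
  by rewrite max_l ?ge_max ?mulr0//; apply/andP; split; lra.
- rewrite /c ival1 -[RHS]/(clamp 1); congr clamp.
  by rewrite (@max_r _ _ (1 - 4^-1)) ?max_r//; lra.
Qed.

Lemma loop_concat1l (f : loop) : path_homotopic (loop_concat loop_cst f) f.
Proof.
apply: (reparam_homotopic (h := f) (phi := second_half) (psi := id)) => //.
- exact: second_half_continuous.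
- by move=> t; exact: cvg_id.
- move=> t; rewrite /= /mk_path /concat_fun; case: ifP => // t2.
  rewrite /second_half clamp_le0; last lra.
  by rewrite -zeroE path_zero.
- by rewrite /second_half ival0 clamp_le0//; lra.
- exact: second_half1.
Qed.

Lemma loop_concat1r (f : loop) : path_homotopic (loop_concat f loop_cst) f.
Proof.
apply: (reparam_homotopic (h := f) (phi := first_half) (psi := id)) => //.
- exact: first_half_continuous.
- by move=> t; exact: cvg_id.
- move=> t; rewrite /= /mk_path /concat_fun; have [//|t2] := leP (ival t) 2^-1.
  rewrite /first_half clamp_ge1; last lra.
  by rewrite -oneE path_one.
- exact: first_half0.
- by rewrite /first_half ival1 clamp_ge1//; lra.
Qed.

Lemma loop_revK (f : loop) : loop_rev (loop_rev f) = f.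
Proof.
apply/path_eqP => t; rewrite /= /mk_path /=; congr (f _).
have t0 := ival_ge0 t; have t1 := ival_le1 t.
rewrite /irev clampK; last by apply/andP; split; lra.
by rewrite opprB addrC subrK ivalK.
Qed.

Lemma loop_concatVl (f : loop) :
  path_homotopic (loop_concat (loop_rev f) f) loop_cst.
Proof.
pose c (t : I) : R := Num.max (1 - 2 * ival t) (2 * ival t - 1).
have cc : continuous c.
  apply: cmax; first exact: csub (@ccst _ _ _) (cmul (@ccst _ _ _) ival_continuous).
  exact: csub (cmul (@ccst _ _ _) ival_continuous) (@ccst _ _ _).
apply: (reparam_homotopic (h := f) (phi := fun t => clamp (c t))
  (psi := cst one)) => //.
- exact: continuous_clamp_comp.
- exact: (@ccst _ _ _).
- move=> t; have t0 := ival_ge0 t; have t1 := ival_le1 t.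
  rewrite /= /mk_path /concat_fun; have [t2|t2] := leP (ival t) 2^-1.
    rewrite /= /irev /first_half clampK; last by apply/andP; split; lra.
    by rewrite /c max_l; last lra.
  by rewrite /c max_r; last lra.
- by move=> t; rewrite /= path_one.
- rewrite /c ival0 -[RHS]/(clamp 1) max_l; last lra.
  by congr clamp; lra.
- rewrite /c ival1 -[RHS]/(clamp 1) max_r; last lra.
  by congr clamp; lra.
Qed.

Lemma loop_concatVr (f : loop) :
  path_homotopic (loop_concat f (loop_rev f)) loop_cst.
Proof. by have := loop_concatVl (loop_rev f); rewrite loop_revK. Qed.

Definition pi1 : Type := {eq_quot path_homotopy_equiv}.

HB.instance Definition _ := Choice.on pi1.
HB.instance Definition _ := EqQuotient.on pi1.

Definition loop_class (f : loop) : pi1 := \pi_pi1 f.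

Lemma loop_classP (f g : loop) :
  loop_class f = loop_class g <-> path_homotopic f g.
Proof. by split => [/eqmodP/asboolP//|fg]; apply/eqmodP/asboolP. Qed.

Lemma loop_class_repr (x : pi1) : loop_class (generic_quotient.repr x) = x.
Proof. exact: reprK. Qed.

Lemma repr_loop_class (f : loop) : path_homotopic (generic_quotient.repr (loop_class f)) f.
Proof. by apply/loop_classP; rewrite loop_class_repr. Qed.

Definition pi1_mul (x y : pi1) : pi1 :=
  loop_class (loop_concat (generic_quotient.repr x) (generic_quotient.repr y)).
Definition pi1_one : pi1 := loop_class loop_cst.
Definition pi1_inv (x : pi1) : pi1 := loop_class (loop_rev (generic_quotient.repr x)).

Lemma pi1_mulE (f g : loop) :
  pi1_mul (loop_class f) (loop_class g) = loop_class (loop_concat f g).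
Proof.
by apply/loop_classP; apply: loop_concat_homotopic; exact: repr_loop_class.
Qed.

Lemma pi1_invE (f : loop) : pi1_inv (loop_class f) = loop_class (loop_rev f).
Proof. by apply/loop_classP; apply: loop_rev_homotopic; exact: repr_loop_class. Qed.

Lemma pi1_mulA : associative pi1_mul.
Proof.
move=> x y z; rewrite -(loop_class_repr x) -(loop_class_repr y).
rewrite -(loop_class_repr z) !pi1_mulE; apply/loop_classP.
exact: loop_concatA.
Qed.

Lemma pi1_mul1l : left_id pi1_one pi1_mul.
Proof.
move=> x; rewrite -(loop_class_repr x) pi1_mulE; apply/loop_classP.
exact: loop_concat1l.
Qed.

Lemma pi1_mul1r : right_id pi1_one pi1_mul.
Proof.
move=> x; rewrite -(loop_class_repr x) pi1_mulE; apply/loop_classP.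
exact: loop_concat1r.
Qed.

Lemma pi1_mulVl : left_inverse pi1_one pi1_inv pi1_mul.
Proof.
move=> x; rewrite -(loop_class_repr x) pi1_invE pi1_mulE; apply/loop_classP.
exact: loop_concatVl.
Qed.

Lemma pi1_mulVr : right_inverse pi1_one pi1_inv pi1_mul.
Proof.
move=> x; rewrite -(loop_class_repr x) pi1_invE pi1_mulE; apply/loop_classP.
exact: loop_concatVr.
Qed.

HB.instance Definition _ :=
  isGroup.Build pi1 pi1_mulA pi1_mul1l pi1_mul1r pi1_mulVl pi1_mulVr.

End PathHomotopy.

Arguments pi1 R {X} x0.

Section InducedMap.
Context {R : realType} {X Y : topologicalType} (f : X -> Y).
Context (cf : continuous f) (x0 : X) (y0 : Y) (fx0 : f x0 = y0).
Local Notation I := (unit_interval R).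

Lemma loop_map_continuous (p : {path I from x0 to x0}) : continuous (f \o p).
Proof. exact: ccomp (@cts_fun _ _ p) cf. Qed.

Lemma loop_map_zero (p : {path I from x0 to x0}) : (f \o p) zero = y0.
Proof. by rewrite /= path_zero. Qed.

Lemma loop_map_one (p : {path I from x0 to x0}) : (f \o p) one = y0.
Proof. by rewrite /= path_one. Qed.

Definition loop_map (p : {path I from x0 to x0}) : {path I from y0 to y0} :=
  mk_path (@loop_map_continuous p) (loop_map_zero p) (loop_map_one p).

Lemma loop_map_homotopic (p q : {path I from x0 to x0}) :
  path_homotopic p q -> path_homotopic (loop_map p) (loop_map q).
Proof.
case=> H [cH H0 H1 Hz Ho]; exists (f \o H); split.
- exact: ccomp cH cf.
- by move=> t /=; rewrite H0.
- by move=> t /=; rewrite H1.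
- by move=> s /=; rewrite Hz.
- by move=> s /=; rewrite Ho.
Qed.

Definition pi1_map (x : pi1 R x0) : pi1 R y0 :=
  loop_class (loop_map (generic_quotient.repr x)).

Lemma pi1_mapE (p : {path I from x0 to x0}) :
  pi1_map (loop_class p) = loop_class (loop_map p).
Proof.
by apply/loop_classP; apply: loop_map_homotopic; exact: repr_loop_class.
Qed.

Lemma pi1_mapM (x y : pi1 R x0) :
  pi1_map (x * y)%g = (pi1_map x * pi1_map y)%g.
Proof.
rewrite -(loop_class_repr x) -(loop_class_repr y).
rewrite [(_ * _)%g]pi1_mulE !pi1_mapE [RHS]pi1_mulE; congr loop_class.
by apply/path_eqP => t; rewrite /= /mk_path /= /concat_fun /=; case: ifP.
Qed.

HB.instance Definition _ :=
  isMultiplicative.Build (pi1 R x0) (pi1 R y0) pi1_map pi1_mapM.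

End InducedMap.

(* Universal property of the free group on the family [x]. *)
Definition freely_generates (G : groupType) (K : Type) (x : K -> G) : Prop :=
  forall (H : groupType) (y : K -> H),
    exists phi : {multiplicative G -> H},
      (forall k, phi (x k) = y k) /\
      (forall psi : {multiplicative G -> H},
         (forall k, psi (x k) = y k) -> psi =1 phi).

Notation P1 R := (one_point_compactification R[i]^o).

Section PuncturedSphere.
Context {R : realType}.

Definition inftyP1 : P1 R := None.
Definition affineP1 (z : R[i]) : P1 R := Some z.

Definition iotaP1 (P : P1 R) : P1 R := if P is Some z then Some (- z) else None.

Lemma iotaK : involutive iotaP1.
Proof. by case=> [z|//]; rewrite /= opprK. Qed.

Lemma oppC_continuous : continuous (fun z : R[i]^o => - z : R[i]^o).
Proof. exact: opp_continuous. Qed.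

Lemma iota_continuous : continuous iotaP1.
Proof.
case=> [z|] A.
  rewrite /= => hA; exact: (oppC_continuous hA).
case=> C [cC clC] sCA; exists ((fun z : R[i]^o => - z : R[i]^o) @` C); first split.
- apply: continuous_compact cC; apply: continuous_subspaceT.
  exact: oppC_continuous.
- rewrite (_ : _ @` C = (fun z : R[i]^o => - z : R[i]^o) @^-1` C).
    by apply: preimage_closed => // z _; exact: oppC_continuous.
  apply/seteqP; split => [_ [z Cz <-]|z Cz]; first by rewrite /= opprK.
  by exists (- z) => //; rewrite opprK.
- move=> _ [[z nz <-]|->]; last by apply: sCA; right.
  apply: sCA; left; exists (- z) => // Cz; apply: nz.
  by exists (- z) => //; rewrite opprK.
Qed.

Context {n : nat} (B : 'I_n -> P1 R).

Definition finite_punctures (k : 'I_n + 'I_n) : P1 R :=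
  match k with inl i => B i | inr i => iotaP1 (B i) end.

Definition branch_points : Prop :=
  (forall i, B i <> affineP1 0 /\ B i <> inftyP1) /\ injective finite_punctures.

Definition punctures : set (P1 R) := inftyP1 |` range finite_punctures.

Definition puncturedP1 : set (P1 R) := ~` punctures.

Lemma punctures_iota P : punctures P -> punctures (iotaP1 P).
Proof.
case=> [->|[[i|i] _ <-]]; first by left.
- by right; exists (inr i).
- by right; exists (inl i); rewrite //= iotaK.
Qed.

Lemma U_iota P : puncturedP1 P -> puncturedP1 (iotaP1 P).
Proof. by move=> UP /punctures_iota; rewrite iotaK. Qed.

Lemma iotaU_subproof (P : puncturedP1) : iotaP1 (set_val P) \in puncturedP1.
Proof. by apply/mem_set/U_iota; exact: set_valP. Qed.

Definition iotaU (P : puncturedP1) : puncturedP1 :=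
  @exist (P1 R) (fun Q => Q \in puncturedP1) _ (iotaU_subproof P).

Lemma iotaU_continuous : continuous iotaU.
Proof.
apply: continuous_comp_initial.
exact: ccomp (@initial_continuous _ _ _) iota_continuous.
Qed.

Context (hB : branch_points).

Lemma U0 : affineP1 0 \in puncturedP1.
Proof.
apply/mem_set; case=> [//|[[i|i] _]]; first by case: (hB.1 i).
case: (hB.1 i) => + _ /=; case: (B i) => [z|//] nz [z0]; apply: nz.
by rewrite -[z]opprK z0 oppr0.
Qed.

Definition origin : puncturedP1 := @exist (P1 R) (fun Q => Q \in puncturedP1) _ U0.

Lemma iotaU_base : iotaU origin = origin.
Proof. by apply: val_inj; rewrite /= /affineP1 oppr0. Qed.

Definition iota_star : pi1 R origin -> pi1 R origin :=
  pi1_map iotaU_continuous iotaU_base.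

Definition loop_image (f : unit_interval R -> puncturedP1) : set (P1 R) :=
  range (fun t => set_val (f t)).

(* A Jordan curve through 0 in the punctured sphere that separates the puncture
   [P] from all the other punctures; either orientation is allowed. *)
Definition simple_loop_around (P : P1 R)
    (f : {path unit_interval R from origin to origin}) : Prop :=
  (forall s t, f s = f t ->
     [\/ s = t, s = zero /\ t = one | s = one /\ t = zero]) /\
  connected_component (~` loop_image f) P `&` punctures = [set P].

Definition simple_loop_class (P : P1 R) (x : pi1 R origin) : Prop :=
  exists2 f, simple_loop_around P f & loop_class f = x.

Context (gamma : 'I_n -> pi1 R origin).

Definition generators (k : 'I_n + 'I_n) : pi1 R origin :=
  match k with inl i => gamma i | inr i => iota_star (gamma i) end.

Definition gamma_infty : pi1 R origin :=
  (\prod_(i < n) gamma i * \prod_(i < n) iota_star (gamma i))%g.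

End PuncturedSphere.

Section Permutations.

Lemma ell_fst_subproof g (i : 'I_(2 * g)) : (2 * i < 4 * g)%N.
Proof. by rewrite -[4%N]/(2 * 2)%N -mulnA ltn_pmul2l. Qed.

Lemma ell_snd_subproof g (i : 'I_(2 * g)) : ((2 * i).+1 < 4 * g)%N.
Proof.
by rewrite -[4%N]/(2 * 2)%N -mulnA [(2 * i)%N]mul2n [ltnRHS]mul2n ltn_Sdouble.
Qed.

(* The point k of {1, ..., 4g} is the element k - 1 of 'I_(4 * g). *)
Definition ell (g : nat) : 'S_(4 * g) :=
  (\prod_(i < 2 * g)
     tperm (Ordinal (ell_fst_subproof i)) (Ordinal (ell_snd_subproof i)))%g.

Definition three_cycle (T : finType) (s : {perm T}) : Prop :=
  exists a b c : T, [/\ uniq [:: a; b; c], s a = b, s b = c, s c = a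
    & forall x, x \notin [:: a; b; c] -> s x = x].

(* [porbits s] also contains the singletons of the fixed points of [s]. *)
Definition cycle_lengths (T : finType) (s : {perm T}) : seq nat :=
  [seq #|C| | C : {set T} <- enum (porbits s)].

End Permutations.

(* Main.v *)
Require Import Defs.
From HB Require Import structures.
From mathcomp Require Import all_boot all_order all_algebra.
From mathcomp Require Import all_fingroup all_solvable complex.
From mathcomp Require Import all_classical all_reals all_analysis.

Local Open Scope group_scope.

(** Freeness makes the topology disappear: for any even [c i] there is a
    homomorphism into the alternating group sending [gamma i] to [c i] and
    [iota_star (gamma i)] to the conjugate of [c i] by [ell].  It sends
    [gamma_infty] to [P * ell^-1 * P * ell] with [P = \prod_i c i].  As [ell] is
    an involution, this is [(P * ell) ^+ 2].  So it suffices to find a square root [t] of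
    [s_infty] such that [t * ell] is a product of exactly [2g] three-cycles.

    All cycles of [s_infty] have odd length, so [s_infty] has odd order and is
    the square of one of its own powers, which is even since [s_infty] is.  Also
    [ell] is a product of an even number of transpositions, so [t * ell] is
    even.  No further choice has to be made, because every even permutation of
    [4g] points is a product of exactly [2g] three-cycles
    ([even_three_cycle_product]).  Indeed, from a permutation with a cycle of
    length at least three one can split off a three-cycle so that two more
    points become fixed ([not_involution_split]); an even involution other than
    the identity contains two disjoint transpositions, which are a product of
    two three-cycles and whose removal fixes four more points
    ([even_involution_split]).  Either way each three-cycle spent fixes two
    points, so at most [2g] of them are used, and a shorter product is
    lengthened with [c = c^-1 * c^-1]. *)

(** * Products of three-cycles *)

Section ThreeCycles.
Variable T : finType.
Implicit Types (s c : {perm T}) (m : nat).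

Definition moved s : pred T := [pred x | s x != x].

Definition three_cycle_product m s : Prop :=
  exists2 cs : seq {perm T}, size cs = m
    & (forall c, c \in cs -> three_cycle c) /\ s = \prod_(c <- cs) c.

Lemma three_cycle_product0 : three_cycle_product 0 1.
Proof. by exists [::] => //; split=> //; rewrite big_nil. Qed.

Lemma three_cycle_productS m c s :
  three_cycle c -> three_cycle_product m s -> three_cycle_product m.+1 (c * s).
Proof.
move=> c3 [cs <- [cs3 ->]]; exists (c :: cs) => //; rewrite big_cons; split=> //.
by move=> d; rewrite inE => /predU1P[->|/cs3].
Qed.

Lemma three_cycle_tperm (a b c : T) :
  uniq [:: a; b; c] -> three_cycle (tperm a b * tperm a c).
Proof.
move=> /[dup] abc /=; rewrite !inE negb_or andbT => /andP[/andP[ab ac] bc].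
exists a, b, c; split=> //; rewrite ?permM.
- by rewrite tpermL tpermD // eq_sym.
- by rewrite tpermR tpermL.
- by rewrite [tperm a b c]tpermD // tpermR.
- move=> x; rewrite !inE !negb_or => /and3P[xa xb xc].
  by rewrite permM !tpermD // eq_sym.
Qed.

Lemma three_cycleV c : three_cycle c -> three_cycle c^-1.
Proof.
move=> [x [y [z [xyz cx cy cz cD]]]]; exists x, z, y; split.
- move: xyz; rewrite /= !inE (eq_sym z y).
  by move: (x == y) (x == z) (y == z) => [] [] [].
- by rewrite -cz permK.
- by rewrite -cy permK.
- by rewrite -cx permK.
- move=> w wD; apply: (@perm_inj _ c); rewrite permKV cD //.
  by move: wD; rewrite !inE (orbC (w == z)).
Qed.

Lemma three_cycle_cube c : three_cycle c -> c ^+ 3 = 1.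
Proof.
move=> [x [y [z [_ cx cy cz cD]]]]; apply/permP => w.
rewrite !expgS expg0 mulg1 !permM perm1.
have [|/cD cw] := boolP (w \in [:: x; y; z]); last by rewrite !cw.
by rewrite !inE => /or3P[] /eqP->; rewrite ?(cx, cy, cz).
Qed.

(** A factor [c] can be replaced by the two factors [c^-1] and [c^-1]. *)
Lemma three_cycle_product_pad1 m s :
  three_cycle_product m.+1 s -> three_cycle_product m.+2 s.
Proof.
case=> -[//|c cs] [<-] [cs3 ->]; have c3 : three_cycle c.
  by apply: cs3; rewrite mem_head.
have -> : \prod_(d <- c :: cs) d = c^-1 * (c^-1 * \prod_(d <- cs) d).
  rewrite big_cons mulgA; congr (_ * _).
  apply: (mulgI c); rewrite mulgA mulgV mul1g; apply: (mulgI c).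
  by rewrite mulgV -(three_cycle_cube _ c3) !expgS expg0 mulg1.
have cV3 := three_cycleV _ c3; do 2!apply: (three_cycle_productS _ _ _ cV3).
by exists cs => //; split=> // d dcs; apply: cs3; rewrite inE dcs orbT.
Qed.

(** The empty product has no factor to replace, so it is lengthened to
    [c * c^-1]: the identity is not a single three-cycle, hence the bound
    [2 <= m]. *)
Lemma three_cycle_product_pad k m s :
  (3 <= #|T|)%N -> (k <= m)%N -> (2 <= m)%N ->
  three_cycle_product k s -> three_cycle_product m s.
Proof.
move=> T3 km m2 sk.
have pad j i : three_cycle_product j.+1 s -> three_cycle_product (i + j.+1) s.
  by move=> sj; elim: i => // i; rewrite addSn addnS;
    apply: three_cycle_product_pad1.
case: k km sk => [_ [cs /size0nil-> [_]]|k km /(pad k (m - k.+1)%N)]; last first.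
  by rewrite subnK.
rewrite big_nil => s1; rewrite -(subnK m2); apply: pad; rewrite {s}s1.
have /card_gt2P[a [b [c [_ [ab bc ca]]]]] := T3.
have c3 : three_cycle (tperm a b * tperm a c).
  by apply: three_cycle_tperm; rewrite /= !inE negb_or ab bc eq_sym ca.
rewrite -(mulgV (tperm a b * tperm a c)) -[_^-1]mulg1.
apply: (three_cycle_productS _ _ _ c3).
apply: (three_cycle_productS _ _ _ (three_cycleV _ c3)).
exact: three_cycle_product0.
Qed.

Lemma card_moved_fix (D : seq T) s s' :
  uniq D -> {in D, forall x, s x != x} -> {in D, forall x, s' x = x} ->
  (forall x, s x = x -> s' x = x) ->
  (#|moved s'| + size D <= #|moved s|)%N.
Proof.
move=> Duniq Dm Df s'_fix; rewrite addnC -(card_uniqP Duniq).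
rewrite -(cardID [in D] (moved s)) leq_add //; apply: subset_leq_card.
  by apply/fintype.subsetP => x xD; rewrite !inE xD Dm.
apply/fintype.subsetP => x; rewrite !inE => s'x; apply/andP; split.
  by apply: contra s'x => xD; rewrite Df.
by apply: contra s'x => /eqP /s'_fix ->.
Qed.

(** The factor is the three-cycle [(a b d)] with [b = s a] and [d = s b]: undoing
    it first sends [b] to [a] and [d] to [b], so that [b] and [d] are fixed by
    the remaining factor, while points outside [a, b, d] are not affected. *)
Lemma not_involution_split s a :
  s (s a) != a -> exists2 c, three_cycle c
    & exists2 s', s = c * s' & (#|moved s'| + 2 <= #|moved s|)%N.
Proof.
set b := s a; set d := s b => da.
have ba : b != a by apply: contra da => /eqP ba; rewrite /d ba -/b ba.
have db : d != b by rewrite (inj_eq perm_inj).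
have [ab ad bd] : [/\ a != b, a != d & b != d] by split; rewrite eq_sym.
exists (tperm a b * tperm a d).
  by apply: three_cycle_tperm; rewrite /= !inE negb_or ab ad bd.
exists (tperm a d * tperm a b * s).
  rewrite -!mulgA (mulgA (tperm a d)) tperm2 mul1g.
  by rewrite mulgA tperm2 mul1g.
apply: (@card_moved_fix [:: b; d]).
- by rewrite /= inE bd.
- by move=> x; rewrite !inE => /orP[] /eqP-> //; rewrite (inj_eq perm_inj).
- move=> x; rewrite !inE => /orP[] /eqP->; rewrite !permM.
    by rewrite (tpermD _ db) // tpermR.
  by rewrite tpermR tpermL.
- move=> x sx; have [xa xb xd] : [/\ a != x, b != x & d != x].
    split; apply: contra_neq ba => Ex.
    + by rewrite /b Ex.
    + by apply: (@perm_inj _ s); rewrite -/b Ex.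
    + by do 2!apply: (@perm_inj _ s); rewrite -/b -/d Ex.
  by rewrite !permM !tpermD.
Qed.

(** Being even, [s] is not a single transposition, so it contains two disjoint
    ones [(a b)] and [(d e)].  Since [(b a d)] is [(b a)] followed by [(b d)] and
    [(d b e)] is [(b d)] followed by [(d e)], their product is [(a b)(d e)]. *)
Lemma even_involution_split s :
  involutive s -> ~~ odd_perm s -> s != 1 ->
  exists c1 c2, [/\ three_cycle c1, three_cycle c2
    & exists2 s', s = c1 * (c2 * s') & (#|moved s'| + 4 <= #|moved s|)%N].
Proof.
move=> sK s_even s1.
have /existsP[a sa] : [exists a, s a != a].
  apply: contraR s1 => /existsPn s_id; apply/eqP/permP => x.
  by rewrite perm1; apply/eqP; rewrite -[_ == _]negbK.
have /existsP[d /and3P[da db sd]] :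
    [exists d, [&& d != a, d != s a & s d != d]].
  apply: contraR s_even => /existsPn s_tperm.
  suff -> : s = tperm a (s a) by rewrite odd_tperm eq_sym sa.
  apply/permP => x; case: tpermP => [->//|->//|/eqP xa /eqP xb].
  by have := s_tperm x; rewrite xa xb negbK => /eqP.
set b := s a in sa db; set e := s d in sd.
have [ea eb] : e != a /\ e != b.
  by rewrite /e -(sK a) -/b !(inj_eq perm_inj).
have neqs : [/\ a != b, a != d, a != e & b != d] /\ [/\ b != e & d != e].
  by do !split; rewrite // eq_sym.
case: neqs => -[ab ad ae bd] [be de].
exists (tperm b a * tperm b d), (tperm d b * tperm d e); split.
- by apply: three_cycle_tperm; rewrite /= !inE negb_or ?sa ?bd ?ad.
- by apply: three_cycle_tperm; rewrite /= !inE negb_or ?db ?de ?be.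
exists (tperm d e * tperm b a * s).
  rewrite (tpermC d b) -!mulgA (mulgA (tperm b d)) tperm2 mul1g.
  by rewrite (mulgA (tperm d e)) tperm2 mul1g mulgA tperm2 mul1g.
apply: (@card_moved_fix [:: a; b; d; e]).
- by rewrite /= !inE !negb_or ab ad ae bd be de.
- move=> x; rewrite !inE => /or4P[] /eqP->; rewrite ?sK // /b /e ?sK eq_sym //.
- move=> x; rewrite !inE => /or4P[] /eqP->; rewrite !permM.
  + by rewrite (tpermD da ea) tpermR sK.
  + by rewrite (tpermD db eb) tpermL.
  + by rewrite tpermL (tpermD be ae) sK.
  + by rewrite tpermR (tpermD bd ad).
- move=> x sx; have [xa xb] : a != x /\ b != x.
    split; apply: contra_neq sa => Ex; first by rewrite /b Ex.
    by rewrite -(sK a) -/b Ex.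
  have [xd xe] : d != x /\ e != x.
    split; apply: contra_neq sd => Ex; first by rewrite /e Ex.
    by rewrite -(sK d) -/e Ex.
  by rewrite !permM !tpermD.
Qed.

Lemma three_cycle_even c : three_cycle c -> ~~ odd_perm c.
Proof.
move=> /three_cycle_cube c3; apply/negP => co; have := odd_perm1 T.
by rewrite -c3 !expgS expg0 mulg1 !odd_permM co.
Qed.

Lemma even_three_cycle_product_le m s :
  ~~ odd_perm s -> (#|moved s| <= m.*2)%N ->
  exists2 k, (k <= m)%N & three_cycle_product k s.
Proof.
elim/ltn_ind: m s => m IHm s s_even sm.
have [->|s1] := eqVneq s 1; first by exists 0; last exact: three_cycle_product0.
have [/forallP sK|/forallPn[a sa]] := boolP [forall x, s (s x) == x].
  have [|c1 [c2 [c13 c23 [s' Es s's]]]] := even_involution_split s _ s_even s1.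
    by move=> x; apply/eqP.
  have s'_even : ~~ odd_perm s'.
    move: s_even; rewrite Es !odd_permM.
    by rewrite (negPf (three_cycle_even _ c13)) (negPf (three_cycle_even _ c23)).
  have := leq_trans s's sm; case: m IHm {sm} => [|[|m]] IHm.
  - by rewrite addnS.
  - by rewrite !addnS.
  rewrite !doubleS !addnS addn0 !ltnS => s'm.
  have [//|//|k km s'k] := IHm m _ s' s'_even.
  exists k.+2 => //; rewrite Es.
  exact: three_cycle_productS _ _ _ c13 (three_cycle_productS _ _ _ c23 s'k).
have [c c3 [s' Es s's]] := not_involution_split s a sa.
have s'_even : ~~ odd_perm s'.
  by move: s_even; rewrite Es odd_permM (negPf (three_cycle_even _ c3)).
have := leq_trans s's sm; case: m IHm {sm} => [|m] IHm; first by rewrite addnS.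
rewrite doubleS !addnS addn0 !ltnS => s'm.
have [//|//|k km s'k] := IHm m _ s' s'_even.
by exists k.+1 => //; rewrite Es; apply: three_cycle_productS.
Qed.

Lemma even_three_cycle_product m s :
  (3 <= #|T|)%N -> (#|T| <= m.*2)%N -> (2 <= m)%N -> ~~ odd_perm s ->
  three_cycle_product m s.
Proof.
move=> T3 Tm m2 s_even.
have [k km] :=
  even_three_cycle_product_le m s s_even (leq_trans (max_card _) Tm).
exact: three_cycle_product_pad.
Qed.

End ThreeCycles.

(** * Square roots of permutations with odd cycles *)

(** The product [N] of the odd numbers [#|porbit s x|] is odd and annihilates
    [s], so [s = s ^+ N.+1] is the square of [s ^+ (N.+1)./2]. *)
Lemma odd_cycles_sqrt (T : finType) (s : {perm T}) :
  (forall k, k \in cycle_lengths s -> odd k) -> exists k, s ^+ k ^+ 2 = s.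
Proof.
move=> s_odd; pose N := (\prod_x #|porbit s x|)%N.
have sN : s ^+ N = 1.
  apply/permP => x; rewrite perm1 permX /N (bigD1 x) //= mulnC.
  by elim: (X in (X * _)%N) => // i IHi; rewrite mulSn iterD IHi iter_porbit.
have N_odd : odd N.
  apply: (big_ind odd) => // [i j i_odd|x _]; first by rewrite oddM i_odd.
  apply: s_odd; apply/mapP; exists (porbit s x) => //.
  by rewrite mem_enum; apply: imset_f.
have NE : (uphalf N * 2)%N = N.+1.
  by rewrite muln2 uphalf_half -[in RHS](odd_double_half N) N_odd.
by exists (uphalf N); rewrite -expgM NE expgS sN mulg1.
Qed.

(** * Homomorphisms into a subgroup *)

Section SubgroupInclusion.
Variables (gT : finGroupType) (G : {group gT}).

Let sgval_mul : {morph @sgval gT G : x y / x * y}. Proof. by []. Qed.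
HB.instance Definition _ :=
  isMultiplicative.Build (subg_of G) gT (@sgval gT G) sgval_mul.

(** The universal property is applied to the subgroup as a group in its own
    right, which keeps the values on all of [F], not only on the generators,
    inside [G]. *)
Lemma freely_generates_subg (F : groupType) (K : Type) (x : K -> F)
    (y : K -> gT) :
  freely_generates x -> (forall k, y k \in G) ->
  exists m : {multiplicative F -> gT},
    (forall k, m (x k) = y k) /\ forall z, m z \in G.
Proof.
move=> x_free yG.
have [phi [phix _]] := x_free (subg_of G) (fun k => Subg (yG k)).
exists (@sgval gT G \o phi : {multiplicative F -> gT}).
by split=> [k|z]; [rewrite /= phix | exact: subgP].
Qed.

End SubgroupInclusion.

(** * The involution ell *)

Lemma ell_even g : ~~ odd_perm (ell g).
Proof.
rewrite /ell (big_morph _ (@odd_permM _) (odd_perm1 _)).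
rewrite (eq_bigr (fun=> true)) => [|i _]; last first.
  by rewrite odd_tperm -(inj_eq val_inj) /= neq_ltn ltnSn.
rewrite big_const_ord mul2n; suff -> : iter g.*2 (addb true) false = odd g.*2.
  by rewrite odd_double.
by elim: g.*2 => //= k ->.
Qed.

Lemma ell_involution g : ell g * ell g = 1.
Proof.
rewrite /ell -prodgM_commute => [|i j _ _].
  by apply: big1 => i _; exact: tperm2.
have [->//|ij] := eqVneq i j.
apply: (@perm_onC _ _ _ _ _ (tperm_on _ _) (tperm_on _ _)).
rewrite -setI_eq0; apply/eqP/finset.setP => x; rewrite !inE.
apply/negP => /andP[/orP[]/eqP-> /orP[]/eqP[]]; rewrite (mul2n i) (mul2n j).
- by move/double_inj/val_inj/eqP; rewrite (negPf ij).
- by move/(congr1 odd); rewrite /= !odd_double.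
- by move/(congr1 odd); rewrite /= !odd_double.
- by move/double_inj/val_inj/eqP; rewrite (negPf ij).
Qed.

Theorem proposition3p3 (R : realType) (g : nat) (g_ge1 : (1 <= g)%N)
    (B : 'I_(2 * g) -> P1 R) (hB : branch_points B)
    (gamma : 'I_(2 * g) -> pi1 R (origin hB))
    (gamma_simple : forall i, simple_loop_class (B i) (gamma i))
    (gamma_free : freely_generates (generators gamma))
    (gamma_infty_simple : simple_loop_class inftyP1 (gamma_infty gamma))
    (s_infty : 'S_(4 * g)) (s_infty_even : s_infty \in 'Alt_('I_(4 * g)))
    (n : 'I_(2 * g + 2) -> nat) (sum_n : (\sum_i n i = g - 1)%N)
    (s_infty_cycles :
      perm_eq (cycle_lengths s_infty) [seq (2 * n i + 1)%N | i : 'I_(2 * g + 2)]) :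
  exists m : {multiplicative pi1 R (origin hB) -> 'S_(4 * g)},
    [/\ forall x, m x \in 'Alt_('I_(4 * g)),
        m (gamma_infty gamma) = s_infty
      & forall i, three_cycle (m (gamma i)) /\
          m (iota_star (gamma i)) = (ell g)^-1 * m (gamma i) * ell g].
Proof.
have gg2 : (2 <= 2 * g)%N by rewrite -[2%N]muln1 leq_mul2l.
have N : #|'I_(4 * g)| = (2 * g).*2 by rewrite card_ord -mul2n mulnA.
have [|k tt] := @odd_cycles_sqrt _ s_infty.
  move=> k; rewrite (perm_mem s_infty_cycles) => /mapP[i _ ->].
  by rewrite addn1 /= mul2n odd_double.
set t := s_infty ^+ k in tt.
have t_even : ~~ odd_perm (t * ell g).
  rewrite odd_permM (negPf (ell_even g)) addbF -Alt_even.
  exact: groupX.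
have [||||cs cs_size [cs3 tE]] :=
  @even_three_cycle_product _ (2 * g) (t * ell g).
- by rewrite N -addnn; exact: (@leq_add 2 1 _ _ gg2 (ltnW gg2)).
- by rewrite N.
- exact: gg2.
- exact: t_even.
pose c (i : 'I_(2 * g)) := nth 1 cs i.
have c3 i : three_cycle (c i) by apply: cs3; rewrite mem_nth // cs_size.
have cP : \prod_i c i = t * ell g.
  by rewrite tE (big_nth 1) cs_size big_mkord.
pose y (j : 'I_(2 * g) + 'I_(2 * g)) :=
  match j with inl i => c i | inr i => c i ^ ell g end.
have [m [m_gamma m_Alt]] :
    exists m : {multiplicative pi1 R (origin hB) -> 'S_(4 * g)},
      (forall j, m (generators gamma j) = y j) /\
      forall x, m x \in 'Alt_('I_(4 * g)).
  apply: freely_generates_subg => // j; rewrite Alt_even.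
  by case: j => i; rewrite /y ?odd_permJ; exact: three_cycle_even _ (c3 i).
exists m; split=> //; last first.
  move=> i; have := m_gamma (inl i); have := m_gamma (inr i).
  by move=> /= -> ->; split; [exact: c3|rewrite conjgE mulgA].
have m1 : m 1 = 1 by apply: (mulgI (m 1)); rewrite -gmulfM !mulg1.
rewrite /gamma_infty gmulfM !(big_morph m (gmulfM (s := m)) m1).
rewrite (eq_bigr c) => [|i _]; last exact: m_gamma (inl i).
rewrite [X in _ * X](eq_bigr (fun i => c i ^ ell g)) => [|i _]; last first.
  exact: m_gamma (inr i).
rewrite -conjg_prod cP conjgE.
by rewrite -!mulgA mulKVg ell_involution mulg1.
Qed.
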